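(* Let $\mathcal F\colon\mathcal C\to\mathcal C$ be an endofunctor, let $(T,1_T),(E,f_E),(R,\sigma)$ be a setting for dynamic stability in the category of $\mathcal F$-systems, with $f_E\colon E\to\mathcal F E$ an $\mathcal F$-system, and suppose the posetal structure on $R$ is induced pointwise. Let $\phi\colon T\times E\to E$ be a trajectory flow for $f_E$ and let $x^*\colon 1\to E$ be an equilibrium point of $\phi$. If $V\colon E\to R$ is a morphism such that (i) $V$ is positive definite with respect to $x^*$, i.e. there are class $\mathcal K$ morphisms $\underline\alpha,\overline\alpha\colon R\to R$ with $\underline\alpha\circ\|\cdot\|_{x^*}\le V\le\overline\alpha\circ\|\cdot\|_{x^*}$, and (ii) $\mathcal F V\circ f_E\le\sigma\circ V$ in $\mathcal C(E,\mathcal F R)$, then $V$ is a Lyapunov morphism for $\phi$ with equilibrium point $x^*$, and thus $x^*$ is stable.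
   Context: Conventions. $\mathcal C$ is a category with all finite products and terminal object $1$; $!\colon X\to 1$ is the unique map; $\langle a,b\rangle$ denotes pairing into a product; $\pi$ denotes a product projection. An $\mathcal F$-system is a morphism $f\colon X\to\mathcal F X$; a morphism of $\mathcal F$-systems from $f\colon X\to\mathcal FX$ to $g\colon Y\to\mathcal FY$ is $p\colon X\to Y$ with $\mathcal Fp\circ f=g\circ p$. An object $R$ is posetal if every hom-set $\mathcal C(A,R)$ carries a partial order $\le$ such that precomposition with any $A'\to A$ is order-preserving. The posetal structure on $R$ is induced pointwise if for all $f,g\colon A\to R$, $f\circ x\le g\circ x$ for all points $x\colon 1\to A$ implies $f\le g$. Setting for dynamic stability. It consists of: an object $E$ (space); a monoid object $(T,\oplus,0_\oplus)$ (time); a posetal object $R$ with a point $o_R\colon 1\to R$; a morphism $d\colon E\times E\to R$ with $d\ge o_R\circ !$ and such that the diagonal $\Delta\colon E\to E\times E$ is the kernel of $d$ (the equalizer of $d$ and $o_R\circ !$); an $\mathcal F$-system $1_T\colon T\to\mathcal FT$ (unit clock); an $\mathcal F$-system $\sigma\colon R\to\mathcal FR$ (stable system); a posetal structure on $\mathcal FR$; subject to the comparison lemma axiom: for every $\gamma\colon T\to R$, if $\mathcal F\gamma\circ 1_T\le\sigma\circ\gamma$, then $\gamma\le\gamma_0$, where $\gamma_0:=\gamma\circ 0_\oplus\circ !\colon T\to R$. Flows. A $T$-flow on $E$ is a monoid action $\phi\colon T\times E\to E$: $\phi\circ\langle 0_\oplus\circ !,\mathrm{id}_E\rangle=\mathrm{id}_E$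 and $\phi\circ(\oplus\times\mathrm{id}_E)=\phi\circ(\mathrm{id}_T\times\phi)$. A trajectory for $f_E$ is a morphism $c\colon T\to E$ with $\mathcal Fc\circ 1_T=f_E\circ c$. A trajectory flow for $f_E$ is a $T$-flow $\phi$ such that for each $x_0\colon 1\to E$ the composite $\phi\circ\langle\mathrm{id}_T,x_0\circ !\rangle\colon T\to E$ is a trajectory for $f_E$. A point $x^*\colon 1\to E$ is an equilibrium point of $\phi$ if $\phi\circ\langle\mathrm{id}_T,x^*\circ !\rangle=x^*\circ !\colon T\to E$. Stability. $\|\cdot\|_{x^*}:=d\circ\langle\mathrm{id}_E,x^*\circ !\rangle\colon E\to R$. A morphism $\alpha\colon R\to R$ is class $\mathcal K$ if it is order-preserving (postcomposition with $\alpha$ is order-preserving on each $\mathcal C(A,R)$), has an order-preserving inverse, and $\alpha\circ o_R=o_R$. The equilibrium point $x^*$ is stable if there is a class $\mathcal K$ morphism $\alpha$ with $\|\cdot\|_{x^*}\circ\phi\le\alpha\circ\|\cdot\|_{x^*}\circ\pi_E$ in $\mathcal C(T\times E,R)$. A Lyapunov morphism for $\phi$ with equilibrium point $x^*$ is a positive definite $V\colon E\to R$ with $V\circ\phi\le V\circ\pi_E$ in $\mathcal C(T\times E,R)$. *)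

(* Defs.v *)
From Stdlib Require Export Relation_Definitions.

Set Implicit Arguments.
Unset Strict Implicit.
Unset Printing Implicit Defensive.

Declare Scope cat_scope.
Delimit Scope cat_scope with cat.
Open Scope cat_scope.

Record category := Category {
  ob :> Type;
  hom : ob -> ob -> Type;
  idm : forall A, hom A A;
  comp : forall A B C, hom B C -> hom A B -> hom A C;
  comp_id_l : forall A B (f : hom A B), comp (idm B) f = f;
  comp_id_r : forall A B (f : hom A B), comp f (idm A) = f;
  comp_assoc : forall A B C D (h : hom C D) (g : hom B C) (f : hom A B),
    comp h (comp g f) = comp (comp h g) f
}.

Arguments idm {c} A.
Notation "g ∘ f" := (comp g f) (at level 40, left associativity) : cat_scope.

(* Finite products are given by a chosen terminal object and chosen binary
   products. *)
Record cartesian_category := CartesianCategory {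
  cart_cat :> category;
  one : cart_cat;
  bang : forall X, hom X one;
  bang_unique : forall X (f : hom X one), f = bang X;
  product : cart_cat -> cart_cat -> cart_cat;
  pr1 : forall A B, hom (product A B) A;
  pr2 : forall A B, hom (product A B) B;
  pairing : forall X A B, hom X A -> hom X B -> hom X (product A B);
  pr1_pairing : forall X A B (f : hom X A) (g : hom X B),
    pr1 A B ∘ pairing f g = f;
  pr2_pairing : forall X A B (f : hom X A) (g : hom X B),
    pr2 A B ∘ pairing f g = g;
  pairing_unique : forall X A B (h : hom X (product A B)),
    h = pairing (pr1 A B ∘ h) (pr2 A B ∘ h)
}.

Arguments one {c}.
Arguments bang {c} X.
Arguments pr1 {c} A B.
Arguments pr2 {c} A B.
Notation "A × B" := (product A B) (at level 40, left associativity) : cat_scope.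
Notation "⟨ f , g ⟩" := (pairing f g) (format "⟨ f ,  g ⟩") : cat_scope.

Definition prod_map (C : cartesian_category) (A A' B B' : C)
    (f : hom A A') (g : hom B B') : hom (A × B) (A' × B') :=
  ⟨f ∘ pr1 A B, g ∘ pr2 A B⟩.

Definition prod_assoc (C : cartesian_category) (A B D : C) :
    hom ((A × B) × D) (A × (B × D)) :=
  ⟨pr1 A B ∘ pr1 (A × B) D,
   ⟨pr2 A B ∘ pr1 (A × B) D, pr2 (A × B) D⟩⟩.

Definition diag (C : cartesian_category) (A : C) : hom A (A × A) :=
  ⟨idm A, idm A⟩.

Definition is_equalizer (C : category) (K A B : C)
    (e : hom K A) (f g : hom A B) : Prop :=
  f ∘ e = g ∘ e /\
  forall (X : C) (h : hom X A), f ∘ h = g ∘ h -> exists! k : hom X K, e ∘ k = h.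

Record endofunctor (C : category) := Endofunctor {
  fob :> C -> C;
  fmap : forall A B, hom A B -> hom (fob A) (fob B);
  fmap_id : forall A, fmap (idm A) = idm (fob A);
  fmap_comp : forall A B D (g : hom B D) (f : hom A B),
    fmap (g ∘ f) = fmap g ∘ fmap f
}.

Definition system (C : category) (F : endofunctor C) (X : C) : Type :=
  hom X (F X).

Definition is_system_morphism (C : category) (F : endofunctor C) (X Y : C)
    (f : system F X) (g : system F Y) (p : hom X Y) : Prop :=
  fmap F p ∘ f = g ∘ p.

Record posetal (C : category) (R : C) := Posetal {
  leh : forall A : C, relation (hom A R);
  leh_order : forall A, order (hom A R) (@leh A);
  leh_precomp : forall (A A' : C) (h : hom A' A) (f g : hom A R),
    leh f g -> leh (f ∘ h) (g ∘ h)
}.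

Notation "f ≤[ P ] g" := (leh P f g)
  (at level 70, no associativity, format "f  ≤[ P ]  g") : cat_scope.

Definition induced_pointwise (C : cartesian_category) (R : C) (P : posetal R) :
    Prop :=
  forall (A : C) (f g : hom A R),
    (forall x : hom one A, f ∘ x ≤[P] g ∘ x) -> f ≤[P] g.

Record monoid_object (C : cartesian_category) := MonoidObject {
  mon_ob :> C;
  mon_op : hom (mon_ob × mon_ob) mon_ob;
  mon_unit : hom one mon_ob;
  mon_assoc :
    mon_op ∘ prod_map mon_op (idm mon_ob)
    = mon_op ∘ prod_map (idm mon_ob) mon_op ∘ prod_assoc mon_ob mon_ob mon_ob;
  mon_unit_l : mon_op ∘ ⟨mon_unit ∘ bang mon_ob, idm mon_ob⟩ = idm mon_ob;
  mon_unit_r : mon_op ∘ ⟨idm mon_ob, mon_unit ∘ bang mon_ob⟩ = idm mon_ob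
}.

(* The posetal structure [poF] on F R is a datum of its own; it is not derived
   from [poR]. *)
Record stability_setting (C : cartesian_category) (F : endofunctor C) :=
  StabilitySetting {
  E : C;
  T : monoid_object C;
  R : C;
  poR : posetal R;
  oR : hom one R;
  dist : hom (E × E) R;
  dist_ge : oR ∘ bang (E × E) ≤[poR] dist;
  dist_kernel : is_equalizer (diag E) dist (oR ∘ bang (E × E));
  clock : system F T;
  sigma : system F R;
  poF : posetal (F R);
  comparison : forall gamma : hom T R,
    fmap F gamma ∘ clock ≤[poF] sigma ∘ gamma ->
    gamma ≤[poR] gamma ∘ mon_unit T ∘ bang T
}.

Definition is_flow (C : cartesian_category) (T : monoid_object C) (E : C)
    (phi : hom (T × E) E) : Prop :=
  phi ∘ ⟨mon_unit T ∘ bang E, idm E⟩ = idm E /\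
  phi ∘ prod_map (mon_op T) (idm E)
  = phi ∘ prod_map (idm T) phi ∘ prod_assoc T T E.

Section Stability.

Variables (C : cartesian_category) (F : endofunctor C).
Variable S : stability_setting F.

Notation E := (E S).
Notation T := (T S).
Notation R := (R S).

Definition is_trajectory (fE : system F E) (c : hom T E) : Prop :=
  is_system_morphism (clock S) fE c.

Definition flow_from (phi : hom (T × E) E) (x : hom one E) : hom T E :=
  phi ∘ ⟨idm T, x ∘ bang T⟩.

Definition is_trajectory_flow (fE : system F E) (phi : hom (T × E) E) : Prop :=
  is_flow phi /\ forall x0 : hom one E, is_trajectory fE (flow_from phi x0).

Definition is_equilibrium (phi : hom (T × E) E) (x : hom one E) : Prop :=
  flow_from phi x = x ∘ bang T.

Definition norm_at (x : hom one E) : hom E R :=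
  dist S ∘ ⟨idm E, x ∘ bang E⟩.

Definition order_preserving (alpha : hom R R) : Prop :=
  forall (A : C) (f g : hom A R),
    f ≤[poR S] g -> alpha ∘ f ≤[poR S] alpha ∘ g.

Definition class_K (alpha : hom R R) : Prop :=
  order_preserving alpha /\
  (exists beta : hom R R,
     alpha ∘ beta = idm R /\ beta ∘ alpha = idm R /\ order_preserving beta) /\
  alpha ∘ oR S = oR S.

Definition is_stable (phi : hom (T × E) E) (x : hom one E) : Prop :=
  exists alpha : hom R R, class_K alpha /\
    norm_at x ∘ phi ≤[poR S] alpha ∘ norm_at x ∘ pr2 T E.

Definition positive_definite (x : hom one E) (V : hom E R) : Prop :=
  exists alpha1 alpha2 : hom R R, class_K alpha1 /\ class_K alpha2 /\
    alpha1 ∘ norm_at x ≤[poR S] V /\ V ≤[poR S] alpha2 ∘ norm_at x.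

Definition is_lyapunov (phi : hom (T × E) E) (x : hom one E) (V : hom E R) :
    Prop :=
  positive_definite x V /\ V ∘ phi ≤[poR S] V ∘ pr2 T E.

End Stability.

(* Main.v *)
(** Along the trajectory [c] starting at a point [x0], hypothesis (ii) makes
    [V ∘ c] satisfy the premise of the comparison axiom, so [V ∘ c] is bounded
    by its value at time zero, which is [V ∘ x0].  As [R] is ordered pointwise,
    testing on the points of [T × E] suffices for the Lyapunov inequality.
    Stability then follows from [α₁ ∘ ‖·‖ ≤ V ≤ α₂ ∘ ‖·‖] with the class K
    morphism [α₁⁻¹ ∘ α₂]. *)

Require Import Defs.

Set Implicit Arguments.
Unset Strict Implicit.

Lemma leh_trans (C : category) (R : C) (P : posetal R) (A : C)
    (f g h : hom A R) : f ≤[P] g -> g ≤[P] h -> f ≤[P] h.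
Proof. apply (ord_trans _ _ (leh_order P A)). Qed.

Lemma pairing_comp (C : cartesian_category) (X Y A B : C)
    (f : hom X A) (g : hom X B) (h : hom Y X) :
  ⟨f, g⟩ ∘ h = ⟨f ∘ h, g ∘ h⟩.
Proof.
  rewrite (pairing_unique (⟨f, g⟩ ∘ h)).
  now rewrite !comp_assoc, pr1_pairing, pr2_pairing.
Qed.

Lemma bang_comp (C : cartesian_category) (X Y : C) (h : hom Y X) :
  bang X ∘ h = bang Y.
Proof. apply bang_unique. Qed.

Lemma bang_one (C : cartesian_category) : bang (one (c := C)) = idm one.
Proof. symmetry; apply bang_unique. Qed.

Section Stability.

Variables (C : cartesian_category) (F : endofunctor C).
Variable S : stability_setting F.

Notation E := (E S).
Notation T := (T S).
Notation R := (R S).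

(** Since [t] is a point, [bang T ∘ t] is the identity of [one], so the constant component collapses
    to [x]. *)
Lemma flow_from_comp (phi : hom (T × E) E) (x : hom one E) (t : hom one T) :
  flow_from phi x ∘ t = phi ∘ ⟨t, x⟩.
Proof.
  unfold flow_from.
  now rewrite <- comp_assoc, pairing_comp, comp_id_l, <- comp_assoc, bang_comp,
    bang_one, comp_id_r.
Qed.

Lemma flow_from_unit (phi : hom (T × E) E) (x : hom one E) :
  is_flow phi -> flow_from phi x ∘ mon_unit T = x.
Proof.
  intros [hunit _].
  transitivity (phi ∘ ⟨mon_unit T ∘ bang E, idm E⟩ ∘ x).
  - now rewrite flow_from_comp, <- comp_assoc, pairing_comp, <- comp_assoc,
      bang_comp, bang_one, comp_id_r, comp_id_l.
  - now rewrite hunit, comp_id_l.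
Qed.

Lemma trajectory_decrease (fE : system F E) (V : hom E R) (c : hom T E) :
  fmap F V ∘ fE ≤[poF S] sigma S ∘ V -> is_trajectory fE c ->
  V ∘ c ≤[poR S] V ∘ c ∘ mon_unit T ∘ bang T.
Proof.
  intros hdec hc; apply comparison.
  (* The trajectory equation [hc] trades [fmap F c ∘ clock S] for [fE ∘ c]; what remains is [hdec]
     precomposed with [c]. *)
  rewrite fmap_comp, <- comp_assoc, hc, !comp_assoc.
  now apply leh_precomp.
Qed.

Lemma trajectory_flow_decrease (fE : system F E) (phi : hom (T × E) E)
    (V : hom E R) :
  induced_pointwise (poR S) -> is_trajectory_flow fE phi ->
  fmap F V ∘ fE ≤[poF S] sigma S ∘ V ->
  V ∘ phi ≤[poR S] V ∘ pr2 T E.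
Proof.
  intros hR [hflow htraj] hdec; apply hR; intros p.
  (* A point of [T × E] splits into a time [t] and an initial state [x]; the bound along the
     trajectory from [x] is then evaluated at [t]. *)
  rewrite (pairing_unique p).
  set (t := pr1 T E ∘ p); set (x := pr2 T E ∘ p).
  pose proof (leh_precomp t (trajectory_decrease hdec (htraj x))) as H.
  rewrite <- (comp_assoc V _ (mon_unit T)), flow_from_unit in H by exact hflow.
  rewrite <- !comp_assoc, flow_from_comp, bang_comp, bang_one, comp_id_r in H.
  now rewrite <- !comp_assoc, pr2_pairing.
Qed.

(** The inverse fixes the base point because [oR S] equals [alpha ∘ oR S], on which [beta] cancels
    [alpha]. *)
Lemma class_K_inverse (alpha : hom R R) :
  class_K alpha -> exists beta : hom R R, class_K beta /\ beta ∘ alpha = idm R.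
Proof.
  intros [hmono [[beta [hab [hba hbeta]]] ho]].
  exists beta; split; [split; [|split]|]; trivial.
  - now exists alpha.
  - transitivity (beta ∘ (alpha ∘ oR S)); [now rewrite ho|].
    now rewrite comp_assoc, hba, comp_id_l.
Qed.

Lemma class_K_comp (alpha beta : hom R R) :
  class_K alpha -> class_K beta -> class_K (alpha ∘ beta).
Proof.
  intros [ha [[a' [haa' [ha'a ha']]] hao]] [hb [[b' [hbb' [hb'b hb']]] hbo]].
  split; [|split].
  - intros A f g hfg; rewrite <- !comp_assoc; auto.
  - exists (b' ∘ a'); split; [|split].
    + now rewrite comp_assoc, <- (comp_assoc alpha), hbb', comp_id_r.
    + now rewrite comp_assoc, <- (comp_assoc b'), ha'a, comp_id_r.
    + intros A f g hfg; rewrite <- !comp_assoc; auto.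
  - now rewrite <- comp_assoc, hbo.
Qed.

Lemma lyapunov_stable (phi : hom (T × E) E) (x : hom one E) (V : hom E R) :
  is_lyapunov phi x V -> is_stable phi x.
Proof.
  intros [[a1 [a2 [ha1 [ha2 [hlow hup]]]]] hV].
  destruct (class_K_inverse ha1) as [b [hb hba]].
  exists (b ∘ a2); split; [now apply class_K_comp|].
  (* Inserting [b ∘ a1] on the left lets monotonicity of [b] strip [b] from both sides, leaving a
     comparison of [a1 ∘ norm_at x ∘ phi] with [a2 ∘ norm_at x ∘ pr2 T E] that passes through
     [V]. *)
  rewrite <- (comp_id_l (norm_at x ∘ phi)), <- hba, <- !comp_assoc.
  apply (proj1 hb); rewrite !comp_assoc.
  apply leh_trans with (V ∘ phi); [now apply leh_precomp|].
  apply leh_trans with (V ∘ pr2 T E); [exact hV | now apply leh_precomp].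
Qed.

End Stability.

Theorem theorem4p5 (C : cartesian_category) (F : endofunctor C)
  (S : stability_setting F) (fE : system F (E S))
  (hR : induced_pointwise (poR S))
  (phi : hom (T S × E S) (E S)) (hphi : is_trajectory_flow fE phi)
  (xstar : hom one (E S)) (hx : is_equilibrium phi xstar)
  (V : hom (E S) (R S))
  (hV : positive_definite xstar V)
  (hdec : fmap F V ∘ fE ≤[poF S] sigma S ∘ V) :
  is_lyapunov phi xstar V /\ is_stable phi xstar.
Proof.
  assert (hL : is_lyapunov phi xstar V).
  { split; [exact hV | now apply trajectory_flow_decrease with fE]. }
  split; [exact hL | exact (lyapunov_stable hL)].
Qed.
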